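(* Let $\alpha:[L_1,L_2]\to\mathbb{R}^3_1$ be a unit speed timelike curve with nonvanishing curvature, and let $\bar\alpha$ be its natural lift, with Frenet frame $\{\bar T(s),\bar N(s),\bar B(s)\}$. Let $u,v,w:[L_1,L_2]\times[T_1,T_2]\to\mathbb{R}$ be $C^1$ functions, let $t_0\in[T_1,T_2]$ be fixed, and consider the surface $$P(s,t)=\bar\alpha(s)+u(s,t)\,\bar T(s)+v(s,t)\,\bar N(s)+w(s,t)\,\bar B(s),\qquad L_1\le s\le L_2,\ T_1\le t\le T_2.$$ Then $\bar\alpha$ is an (isoparametric, at parameter $t=t_0$) asymptotic curve on the surface $P$ if and only if for all $s\in[L_1,L_2]$ $$u(s,t_0)=v(s,t_0)=w(s,t_0)=\frac{\partial w}{\partial t}(s,t_0)=0\qquad\text{and}\qquad \frac{\partial v}{\partial t}(s,t_0)\neq 0 .$$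
   Context: Minkowski 3-space $\mathbb{R}^3_1$ is $\mathbb{R}^3$ with the Lorentzian inner product $g(X,Y)=-x_1y_1+x_2y_2+x_3y_3$ and $\|X\|=\sqrt{|g(X,X)|}$. A vector $X$ is timelike if $g(X,X)<0$, spacelike if $g(X,X)>0$ or $X=0$, and null if $g(X,X)=0$ and $X\ne0$; a curve is timelike (spacelike, null) if all its velocity vectors are. The Lorentzian cross product is $X\times Y=(x_2y_3-x_3y_2,\;x_1y_3-x_3y_1,\;x_2y_1-x_1y_2)$. All curves are smooth. Frenet frame of a unit speed timelike curve $\alpha$ with curvature $\kappa=\|\alpha''\|\neq0$: $T=\alpha'$, $N=T'/\kappa$, $B=-T\times N$ (so $T$ is timelike, $N,B$ spacelike), with $T'=\kappa N$, $N'=\kappa T+\tau B$, $B'=-\tau N$, where $\tau$ is the torsion. Natural lift: $\bar\alpha(s)=\alpha'(s)$, regarded as a curve in $\mathbb{R}^3_1$ (the position vector of $\bar\alpha$ at $s$ is $\alpha'(s)=T(s)$). It is a spacelike curve since $\bar\alpha'=\kappa N$. Standing assumption: $\bar\alpha$ has a timelike or a spacelike binormal, i.e. its principal normal is never null (equivalently $\kappa(s)\neq|\tau(s)|$ for all $s$). Its Frenet frame is $\bar T=\bar\alpha'/\|\bar\alpha'\|=N$, $\bar N=\bar T'/\|\bar T'\|$, and $\bar B$ is the unit vector given by $\bar T\times\bar N=-\bar B$ if $\bar B$ is spacelike ($\bar N$ timelike), and $\bar T\times\bar N=\bar B$ if $\bar B$ is timelike ($\bar N$ spacelike). $\bar\alpha$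 is isoparametric on $P$ at $t_0$ if $P(s,t_0)=\bar\alpha(s)$ for all $s\in[L_1,L_2]$. Writing $n(s,t)=\frac{\partial P}{\partial s}(s,t)\times\frac{\partial P}{\partial t}(s,t)$ for the normal vector of $P$, an isoparametric curve $\bar\alpha$ (at $t_0$) is called an asymptotic curve on $P$ if for every $s\in[L_1,L_2]$ the normal $n(s,t_0)$ is nonzero and parallel to the binormal $\bar B(s)$ of $\bar\alpha$. *)

(* Defs.v *)
(* Stdlib reals with Coquelicot. *)
From Stdlib Require Import Reals.
From Coquelicot Require Import Coquelicot.
Open Scope R_scope.

(** ** One-variable calculus on a closed interval *)

(* [is_derive] with [locally x] restricted to [a, b]: the derivative is
   one-sided at the endpoints, and the values of f outside [a, b] are
   irrelevant when a < b and x is in [a, b]. *)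
Definition is_derive_on (a b : R) (f : R -> R) (x l : R) : Prop :=
  filterdiff f (within (fun y => a <= y <= b) (locally x))
    (fun y : R => scal y l).

Definition ex_derive_on (a b : R) (f : R -> R) (x : R) : Prop :=
  exists l, is_derive_on a b f x l.

(* The derivative, for a < b, x in [a, b] and f differentiable at x within
   [a, b]; meaningless otherwise. *)
Definition Derive_on (a b : R) (f : R -> R) (x : R) : R :=
  iota (is_derive_on a b f x).

Fixpoint Derive_n_on (a b : R) (f : R -> R) (n : nat) : R -> R :=
  match n with
  | O => f
  | S k => Derive_on a b (Derive_n_on a b f k)
  end.

Definition smooth_on (a b : R) (f : R -> R) : Prop :=
  forall n x, a <= x <= b -> ex_derive_on a b (Derive_n_on a b f n) x.

(** ** Functions of two variables on [L1, L2] x [T1, T2] *)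

Definition ds (L1 L2 : R) (f : R -> R -> R) (s t : R) : R :=
  Derive_on L1 L2 (fun r => f r t) s.

Definition dt (T1 T2 : R) (f : R -> R -> R) (s t : R) : R :=
  Derive_on T1 T2 (fun r => f s r) t.

Definition C1_on (L1 L2 T1 T2 : R) (f : R -> R -> R) : Prop :=
  let D := fun p : R * R => L1 <= fst p <= L2 /\ T1 <= snd p <= T2 in
  (forall s t, D (s, t) ->
     ex_derive_on L1 L2 (fun r => f r t) s /\
     ex_derive_on T1 T2 (fun r => f s r) t) /\
  continuous_on D (fun p => f (fst p) (snd p)) /\
  continuous_on D (fun p => ds L1 L2 f (fst p) (snd p)) /\
  continuous_on D (fun p => dt T1 T2 f (fst p) (snd p)).

(** ** Minkowski 3-space *)

(* The vector operations are Coquelicot's [zero], [plus], [opp], [scal] on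
   the product; its (positive definite) [norm] is not used. *)
Definition R31 : Type := (R * R * R)%type.

Definition x1 (X : R31) : R := fst (fst X).
Definition x2 (X : R31) : R := snd (fst X).
Definition x3 (X : R31) : R := snd X.

Definition g (X Y : R31) : R := - x1 X * x1 Y + x2 X * x2 Y + x3 X * x3 Y.

Definition lnorm (X : R31) : R := sqrt (Rabs (g X X)).

Definition timelike (X : R31) : Prop := g X X < 0.
Definition spacelike (X : R31) : Prop := 0 < g X X \/ X = zero.
Definition null (X : R31) : Prop := g X X = 0 /\ X <> zero.

Definition cross (X Y : R31) : R31 :=
  (x2 X * x3 Y - x3 X * x2 Y,
   x1 X * x3 Y - x3 X * x1 Y,
   x2 X * x1 Y - x1 X * x2 Y).

Definition parallel (X Y : R31) : Prop := exists c : R, X = scal c Y.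

(** ** Curves c : [a, b] -> R^3_1 *)

Definition VDerive_on (a b : R) (c : R -> R31) (s : R) : R31 :=
  (Derive_on a b (fun r => x1 (c r)) s,
   Derive_on a b (fun r => x2 (c r)) s,
   Derive_on a b (fun r => x3 (c r)) s).

Definition smooth_curve (a b : R) (c : R -> R31) : Prop :=
  smooth_on a b (fun s => x1 (c s)) /\
  smooth_on a b (fun s => x2 (c s)) /\
  smooth_on a b (fun s => x3 (c s)).

Definition timelike_curve (a b : R) (c : R -> R31) : Prop :=
  forall s, a <= s <= b -> timelike (VDerive_on a b c s).

Definition unit_speed (a b : R) (c : R -> R31) : Prop :=
  forall s, a <= s <= b -> lnorm (VDerive_on a b c s) = 1.

(* Of a unit speed curve. *)
Definition curvature (a b : R) (c : R -> R31) (s : R) : R :=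
  lnorm (VDerive_on a b (VDerive_on a b c) s).

Definition natural_lift (a b : R) (alpha : R -> R31) : R -> R31 :=
  VDerive_on a b alpha.

(* Frenet frame of a spacelike curve, not necessarily of unit speed, with
   non-null principal normal. *)
Definition tangent (a b : R) (c : R -> R31) (s : R) : R31 :=
  scal (/ lnorm (VDerive_on a b c s)) (VDerive_on a b c s).

Definition normal (a b : R) (c : R -> R31) (s : R) : R31 :=
  scal (/ lnorm (VDerive_on a b (tangent a b c) s))
    (VDerive_on a b (tangent a b c) s).

(* T x N = B if B is timelike, T x N = - B if B is spacelike.  B and T x N
   agree up to sign, hence have the same causal character. *)
Definition binormal (a b : R) (c : R -> R31) (s : R) : R31 :=
  let C := cross (tangent a b c s) (normal a b c s) in
  if Rlt_dec (g C C) 0 then C else opp C.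

(* Stated for T' because [normal] is T' divided by its Lorentzian norm, which
   vanishes exactly in the excluded case. *)
Definition principal_normal_never_null (a b : R) (c : R -> R31) : Prop :=
  forall s, a <= s <= b -> ~ null (VDerive_on a b (tangent a b c) s).

(** ** Surfaces P : [L1, L2] x [T1, T2] -> R^3_1 *)

Definition surface_normal (L1 L2 T1 T2 : R) (P : R -> R -> R31) (s t : R)
  : R31 :=
  cross (VDerive_on L1 L2 (fun r => P r t) s)
        (VDerive_on T1 T2 (fun r => P s r) t).

Definition isoparametric (L1 L2 : R) (c : R -> R31) (P : R -> R -> R31)
  (t0 : R) : Prop :=
  forall s, L1 <= s <= L2 -> P s t0 = c s.

Definition asymptotic_curve (L1 L2 T1 T2 : R) (c : R -> R31)
  (P : R -> R -> R31) (t0 : R) : Prop :=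
  isoparametric L1 L2 c P t0 /\
  forall s, L1 <= s <= L2 ->
    surface_normal L1 L2 T1 T2 P s t0 <> zero /\
    parallel (surface_normal L1 L2 T1 T2 P s t0) (binormal L1 L2 c s).

(* c + u T + v N + w B, where T, N, B is the Frenet frame of c. *)
Definition frame_surface (L1 L2 : R) (c : R -> R31) (u v w : R -> R -> R)
  (s t : R) : R31 :=
  plus (c s)
    (plus (scal (u s t) (tangent L1 L2 c s))
      (plus (scal (v s t) (normal L1 L2 c s))
            (scal (w s t) (binormal L1 L2 c s)))).

(* Main.v *)
Require Import Defs.
From Stdlib Require Import Reals Lra.
From Coquelicot Require Import Coquelicot.
Open Scope R_scope.

(** Let E, M, B be the frame of the natural lift c = alpha'.  It is
    pseudo-orthonormal with B = sigma (E x M), sigma = 1 or -1, and its three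
    vectors are linearly independent ([frame_free]).  So P(s, t0) = c(s) means
    exactly u = v = w = 0 at (s, t0) ([isoparametric_iff]).

    Suppose this holds for every s.  Then P(., t0) and c are the same curve,
    and dP/ds = c' = k E with k > 0.  The frame does not depend on t, so
    dP/dt = u_t E + v_t M + w_t B.  In Minkowski space E x (E x M) = g(E,E) M - g(E,M) E = M, whence
    dP/ds x dP/dt = k sigma (v_t B + w_t M) ([frame_cross]).  This vector is
    nonzero and parallel to B if and only if w_t = 0 and v_t <> 0
    ([normal_parallel_binormal]).

    It remains to see that the frame is a frame ([natural_lift_frame]): the
    divisions by lnorm c' and lnorm E' must be legitimate.  As alpha'
    has constant square -1, c' = alpha'' is orthogonal to a timelike vector;
    hence it is spacelike, being of nonzero length.  Differentiating
    g(c, E) = 0 gives g(c, E') = - g(c', E) <> 0, so that E' <> 0; a vector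
    that is neither zero nor null has nonzero square. *)

(** * Calculus on a closed interval *)

(** Every point of a nondegenerate interval is an accumulation point of it:
    this is what makes one-sided derivatives at the endpoints unique. *)
Lemma within_interval_other (a b x : R) (P : R -> Prop) :
  a < b -> a <= x <= b ->
  within (fun y => a <= y <= b) (locally x) P ->
  exists y, y <> x /\ P y.
Proof.
  intros hab hx [d hd].
  pose proof (cond_pos d) as hd0.
  destruct (Rlt_le_dec x b) as [hxb | hxb].
  - set (h := Rmin (d / 2) (b - x)).
    assert (hh : 0 < h <= d / 2 /\ h <= b - x).
    { unfold h; split; [split |];
        [apply Rmin_pos; lra | apply Rmin_l | apply Rmin_r]. }
    exists (x + h); split; [lra |]; apply hd; [| lra].
    change (Rabs (x + h - x) < d).
    replace (x + h - x) with h by ring; rewrite Rabs_pos_eq; lra.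
  - set (h := Rmin (d / 2) (x - a)).
    assert (hh : 0 < h <= d / 2 /\ h <= x - a).
    { unfold h; split; [split |];
        [apply Rmin_pos; lra | apply Rmin_l | apply Rmin_r]. }
    exists (x - h); split; [lra |]; apply hd; [| lra].
    change (Rabs (x - h - x) < d).
    replace (x - h - x) with (- h) by ring.
    rewrite Rabs_Ropp, Rabs_pos_eq; lra.
Qed.

Lemma within_interval_proper (a b x : R) :
  a < b -> a <= x <= b ->
  ProperFilter (within (fun y => a <= y <= b) (locally x)).
Proof.
  intros hab hx; split.
  - intros P hP.
    destruct (within_interval_other a b x P hab hx hP) as [y [_ hy]].
    now exists y.
  - apply within_filter, locally_filter.
Qed.

Lemma within_interval_lim (a b x : R) :
  is_filter_lim (within (fun y => a <= y <= b) (locally x)) x.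
Proof.
  intros P [d hd]; exists d; intros y hy _; now apply hd.
Qed.

(** If l1 and l2 are both derivatives, the difference f - f is approximated
    by (y - x) (l1 - l2) up to half of |y - x| |l1 - l2|, which is impossible
    at a point y <> x unless l1 = l2. *)
Lemma is_derive_on_unique (a b : R) (f : R -> R) (x l1 l2 : R) :
  a < b -> a <= x <= b ->
  is_derive_on a b f x l1 -> is_derive_on a b f x l2 -> l1 = l2.
Proof.
  intros hab hx h1 h2.
  pose proof (within_interval_proper a b x hab hx) as PF.
  pose proof (filterdiff_minus_fct _ _ _ _ h1 h2) as [_ hd].
  specialize (hd x (within_interval_lim a b x)).
  destruct (Req_dec l1 l2) as [e | ne]; [exact e | exfalso].
  assert (he : 0 < Rabs (l1 - l2) / 2).
  { assert (0 < Rabs (l1 - l2)) by (apply Rabs_pos_lt; lra); lra. }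
  specialize (hd (mkposreal _ he)).
  destruct (within_interval_other a b x _ hab hx hd) as [y [hyx hy]].
  revert hy; unfold minus, plus, opp, scal, norm; simpl.
  unfold mult, abs; simpl.
  replace (f y + - f y + - (f x + - f x)
           + - ((y + - x) * l1 + - ((y + - x) * l2)))
    with (- ((y - x) * (l1 - l2))) by ring.
  replace (y + - x) with (y - x) by ring.
  rewrite Rabs_Ropp, Rabs_mult; intros hy.
  assert (0 < Rabs (y - x)) by (apply Rabs_pos_lt; lra).
  simpl in he; nra.
Qed.

Lemma Derive_on_eq (a b : R) (f : R -> R) (x l : R) :
  a < b -> a <= x <= b -> is_derive_on a b f x l -> Derive_on a b f x = l.
Proof.
  intros hab hx h; unfold Derive_on.
  apply (iota_unique (V := R_CompleteNormedModule)); [| exact h].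
  intros y hy; now apply (is_derive_on_unique a b f x).
Qed.

Lemma Derive_on_correct (a b : R) (f : R -> R) (x : R) :
  a < b -> a <= x <= b -> ex_derive_on a b f x ->
  is_derive_on a b f x (Derive_on a b f x).
Proof.
  intros hab hx [l h]; now rewrite (Derive_on_eq a b f x l hab hx h).
Qed.

Lemma is_derive_on_ext (a b : R) (f h : R -> R) (x l : R) :
  a < b -> a <= x <= b -> (forall y, a <= y <= b -> f y = h y) ->
  is_derive_on a b f x l -> is_derive_on a b h x l.
Proof.
  intros hab hx he.
  pose proof (within_interval_proper a b x hab hx) as PF.
  apply filterdiff_ext_loc.
  - apply (filter_forall (F := locally x)); exact he.
  - intros y hy.
    rewrite (is_filter_lim_unique y x hy (within_interval_lim a b x)).
    now apply he.
Qed.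

Lemma is_derive_on_const (a b c x : R) :
  a < b -> a <= x <= b -> is_derive_on a b (fun _ => c) x 0.
Proof.
  intros hab hx.
  pose proof (within_interval_proper a b x hab hx) as PF.
  eapply filterdiff_ext_lin; [apply filterdiff_const |].
  intros y; unfold zero, scal; simpl; unfold mult; simpl; ring.
Qed.

Lemma is_derive_on_plus (a b : R) (f h : R -> R) (x l m : R) :
  a < b -> a <= x <= b ->
  is_derive_on a b f x l -> is_derive_on a b h x m ->
  is_derive_on a b (fun y => f y + h y) x (l + m).
Proof.
  intros hab hx hf hh.
  pose proof (within_interval_proper a b x hab hx) as PF.
  eapply filterdiff_ext_lin; [exact (filterdiff_plus_fct _ _ _ _ hf hh) |].
  intros y; unfold plus, scal; simpl; unfold mult; simpl; ring.
Qed.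

Lemma is_derive_on_continuous (a b : R) (f : R -> R) (x l : R) :
  is_derive_on a b f x l ->
  filterlim f (within (fun y => a <= y <= b) (locally x)) (locally (f x)).
Proof.
  intros hf; apply (filterdiff_continuous_aux f).
  - eexists; exact hf.
  - apply within_interval_lim.
Qed.

Lemma is_derive_on_mult (a b : R) (f h : R -> R) (x l m : R) :
  a < b -> a <= x <= b ->
  is_derive_on a b f x l -> is_derive_on a b h x m ->
  is_derive_on a b (fun y => f y * h y) x (l * h x + f x * m).
Proof.
  intros hab hx hf hh.
  pose proof (within_interval_proper a b x hab hx) as PF.
  assert (cf := is_derive_on_continuous a b f x l hf).
  assert (ch := is_derive_on_continuous a b h x m hh).
  eapply filterdiff_ext_lin.
  - apply (filterdiff_comp_2 f h (fun p q : R => mult p q) _ _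
      (fun p q : R => plus (mult p (h x)) (mult (f x) q)) hf hh).
    apply (filterdiff_mult (K := R_AbsRing) (f x, h x)).
    + intros P [d hP].
      assert (cf' := cf _ (locally_ball (f x) d)).
      assert (ch' := ch _ (locally_ball (h x) d)).
      unfold filtermap in *.
      generalize (filter_and _ _ cf' ch'); apply filter_imp.
      intros y [h1 h2]; apply hP; split; assumption.
    + exact Rmult_comm.
  - intros y; unfold plus, scal; simpl; unfold mult; simpl; ring.
Qed.

Lemma is_derive_on_comp (a b : R) (f h : R -> R) (x l m : R) :
  a < b -> a <= x <= b ->
  is_derive_on a b f x l -> is_derive h (f x) m ->
  is_derive_on a b (fun y => h (f y)) x (l * m).
Proof.
  intros hab hx hf hh.
  pose proof (within_interval_proper a b x hab hx) as PF.
  assert (cf := is_derive_on_continuous a b f x l hf).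
  eapply filterdiff_ext_lin.
  - apply (filterdiff_comp f h _ (fun y : R => scal y m) hf).
    apply (filterdiff_locally h (f x)); [exact cf | exact hh].
  - intros y; unfold scal; simpl; unfold mult; simpl; ring.
Qed.

(** * Derivatives of curves *)

Definition is_vderive_on (a b : R) (c : R -> R31) (s : R) (V : R31) : Prop :=
  is_derive_on a b (fun r => x1 (c r)) s (x1 V) /\
  is_derive_on a b (fun r => x2 (c r)) s (x2 V) /\
  is_derive_on a b (fun r => x3 (c r)) s (x3 V).

Lemma R31_eq (X Y : R31) : x1 X = x1 Y -> x2 X = x2 Y -> x3 X = x3 Y -> X = Y.
Proof.
  destruct X as [[? ?] ?], Y as [[? ?] ?]; unfold x1, x2, x3; simpl.
  now intros -> -> ->.
Qed.

Lemma VDerive_on_eq (a b : R) (c : R -> R31) (s : R) (V : R31) :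
  a < b -> a <= s <= b -> is_vderive_on a b c s V -> VDerive_on a b c s = V.
Proof.
  intros hab hs (h1 & h2 & h3).
  apply R31_eq; unfold VDerive_on, x1, x2, x3; simpl;
    now apply Derive_on_eq.
Qed.

Lemma is_vderive_on_ext (a b : R) (c d : R -> R31) (s : R) (V : R31) :
  a < b -> a <= s <= b -> (forall r, a <= r <= b -> c r = d r) ->
  is_vderive_on a b c s V -> is_vderive_on a b d s V.
Proof.
  intros hab hs he (h1 & h2 & h3).
  split; [| split].
  - exact (is_derive_on_ext a b _ (fun r => x1 (d r)) s _ hab hs
      (fun r hr => f_equal x1 (he r hr)) h1).
  - exact (is_derive_on_ext a b _ (fun r => x2 (d r)) s _ hab hs
      (fun r hr => f_equal x2 (he r hr)) h2).
  - exact (is_derive_on_ext a b _ (fun r => x3 (d r)) s _ hab hs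
      (fun r hr => f_equal x3 (he r hr)) h3).
Qed.

Lemma is_vderive_on_plus (a b : R) (c d : R -> R31) (s : R) (V W : R31) :
  a < b -> a <= s <= b ->
  is_vderive_on a b c s V -> is_vderive_on a b d s W ->
  is_vderive_on a b (fun r => plus (c r) (d r)) s (plus V W).
Proof.
  intros hab hs (c1 & c2 & c3) (d1 & d2 & d3).
  split; [| split].
  - exact (is_derive_on_plus a b _ _ s _ _ hab hs c1 d1).
  - exact (is_derive_on_plus a b _ _ s _ _ hab hs c2 d2).
  - exact (is_derive_on_plus a b _ _ s _ _ hab hs c3 d3).
Qed.

Lemma is_vderive_on_scal (a b : R) (f : R -> R) (c : R -> R31) (s l : R)
  (V : R31) :
  a < b -> a <= s <= b ->
  is_derive_on a b f s l -> is_vderive_on a b c s V ->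
  is_vderive_on a b (fun r => scal (f r) (c r)) s
    (plus (scal l (c s)) (scal (f s) V)).
Proof.
  intros hab hs hf (c1 & c2 & c3).
  split; [| split].
  - exact (is_derive_on_mult a b _ _ s _ _ hab hs hf c1).
  - exact (is_derive_on_mult a b _ _ s _ _ hab hs hf c2).
  - exact (is_derive_on_mult a b _ _ s _ _ hab hs hf c3).
Qed.

Lemma is_vderive_on_const (a b : R) (X : R31) (s : R) :
  a < b -> a <= s <= b -> is_vderive_on a b (fun _ => X) s zero.
Proof.
  intros hab hs; split; [| split]; now apply is_derive_on_const.
Qed.

Lemma is_derive_on_g (a b : R) (c d : R -> R31) (s : R) (V W : R31) :
  a < b -> a <= s <= b ->
  is_vderive_on a b c s V -> is_vderive_on a b d s W ->
  is_derive_on a b (fun r => g (c r) (d r)) s (g V (d s) + g (c s) W).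
Proof.
  intros hab hs (c1 & c2 & c3) (d1 & d2 & d3).
  assert (n1 := is_derive_on_mult a b _ _ s _ _ hab hs
    (is_derive_on_const a b (-1) s hab hs)
    (is_derive_on_mult a b _ _ s _ _ hab hs c1 d1)).
  assert (p2 := is_derive_on_mult a b _ _ s _ _ hab hs c2 d2).
  assert (p3 := is_derive_on_mult a b _ _ s _ _ hab hs c3 d3).
  assert (p := is_derive_on_plus a b _ _ s _ _ hab hs
    (is_derive_on_plus a b _ _ s _ _ hab hs n1 p2) p3).
  cbv beta in p.
  replace (g V (d s) + g (c s) W) with
    (0 * (x1 (c s) * x1 (d s))
     + -1 * (x1 V * x1 (d s) + x1 (c s) * x1 W)
     + (x2 V * x2 (d s) + x2 (c s) * x2 W)
     + (x3 V * x3 (d s) + x3 (c s) * x3 W)) by (unfold g; ring).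
  eapply is_derive_on_ext; [exact hab | exact hs | | exact p].
  intros y _; unfold g; ring.
Qed.

(** The source of all relations between frame vectors and derivatives: a
    constant product is differentiated by the Leibniz rule. *)
Lemma g_const_deriv (a b k : R) (c d : R -> R31) (s : R) (V W : R31) :
  a < b -> a <= s <= b ->
  is_vderive_on a b c s V -> is_vderive_on a b d s W ->
  (forall r, a <= r <= b -> g (c r) (d r) = k) ->
  g V (d s) + g (c s) W = 0.
Proof.
  intros hab hs hc hd hk.
  apply (is_derive_on_unique a b (fun r => g (c r) (d r)) s);
    [exact hab | exact hs | now apply is_derive_on_g |].
  apply (is_derive_on_ext a b (fun _ => k)); [exact hab | exact hs | |].
  - intros y hy; symmetry; now apply hk.
  - now apply is_derive_on_const.
Qed.

(** Smoothness is phrased through iterated derivatives of the coordinates, with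
    the new derivative taken last; the proof moves it to the front. *)
Lemma smooth_curve_VDerive (a b : R) (c : R -> R31) :
  smooth_curve a b c -> smooth_curve a b (VDerive_on a b c).
Proof.
  assert (shift : forall f, smooth_on a b f ->
                  smooth_on a b (Derive_on a b f)).
  { intros f hf n x hx.
    replace (Derive_n_on a b (Derive_on a b f) n)
      with (Derive_n_on a b f (S n)); [now apply hf |].
    clear; induction n as [| n IH]; [reflexivity |].
    simpl in *; now rewrite IH. }
  intros (h1 & h2 & h3); split; [| split]; now apply shift.
Qed.

Lemma smooth_curve_deriv (a b : R) (c : R -> R31) (s : R) :
  a < b -> a <= s <= b -> smooth_curve a b c ->
  is_vderive_on a b c s (VDerive_on a b c s).
Proof.
  intros hab hs (h1 & h2 & h3); split; [| split].
  - exact (Derive_on_correct a b _ s hab hs (h1 O s hs)).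
  - exact (Derive_on_correct a b _ s hab hs (h2 O s hs)).
  - exact (Derive_on_correct a b _ s hab hs (h3 O s hs)).
Qed.

(** * Lorentzian algebra *)

Ltac coords :=
  unfold g, cross, x1, x2, x3, scal, plus, opp, zero; simpl;
  unfold mult, plus, opp, zero, scal; simpl; unfold mult; simpl.

Lemma g_sym (X Y : R31) : g X Y = g Y X.
Proof. unfold g; ring. Qed.

Lemma g_plus_l (X Y Z : R31) : g (plus X Y) Z = g X Z + g Y Z.
Proof. destruct X as [[? ?] ?], Y as [[? ?] ?], Z as [[? ?] ?]; coords; ring. Qed.

Lemma g_scal_l (k : R) (X Y : R31) : g (scal k X) Y = k * g X Y.
Proof. destruct X as [[? ?] ?], Y as [[? ?] ?]; coords; ring. Qed.

Lemma g_scal_r (k : R) (X Y : R31) : g X (scal k Y) = k * g X Y.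
Proof. destruct X as [[? ?] ?], Y as [[? ?] ?]; coords; ring. Qed.

Lemma g_zero_l (X : R31) : g zero X = 0.
Proof. destruct X as [[? ?] ?]; coords; ring. Qed.

Lemma g_cross_l (X Y : R31) : g X (cross X Y) = 0.
Proof. destruct X as [[? ?] ?], Y as [[? ?] ?]; coords; ring. Qed.

Lemma g_cross_r (X Y : R31) : g Y (cross X Y) = 0.
Proof. destruct X as [[? ?] ?], Y as [[? ?] ?]; coords; ring. Qed.

Lemma g_cross_cross (X Y : R31) :
  g (cross X Y) (cross X Y) = g X Y * g X Y - g X X * g Y Y.
Proof. destruct X as [[? ?] ?], Y as [[? ?] ?]; coords; ring. Qed.

(** The sign is opposite to that of the Euclidean triple product. *)
Lemma cross_cross (X Y : R31) :
  cross X (cross X Y) = plus (scal (g X X) Y) (scal (- g X Y) X).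
Proof.
  destruct X as [[? ?] ?], Y as [[? ?] ?]; apply R31_eq; coords; ring.
Qed.

(** The orthogonal complement of a timelike vector is positive definite. *)
Lemma orthogonal_timelike (X Y : R31) :
  timelike X -> g X Y = 0 -> 0 <= g Y Y.
Proof.
  unfold timelike.
  destruct X as [[a1 a2] a3], Y as [[b1 b2] b3].
  unfold g, x1, x2, x3; simpl; intros hX hXY.
  (* Cauchy-Schwarz for the spatial parts against (a1 b1)^2. *)
  assert (e : a1 * b1 = a2 * b2 + a3 * b3) by lra.
  assert (cs : (a1 * b1) * (a1 * b1)
               <= (a2 * a2 + a3 * a3) * (b2 * b2 + b3 * b3)).
  { rewrite e; pose proof (Rle_0_sqr (a2 * b3 - a3 * b2)) as q.
    unfold Rsqr in q; nra. }
  apply Rnot_lt_le; intro hlt.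
  assert (0 <= a2 * a2 + a3 * a3) by nra.
  assert (0 <= b2 * b2 + b3 * b3) by nra.
  nra.
Qed.

Lemma lnorm_neq0 (X : R31) : lnorm X <> 0 -> g X X <> 0.
Proof.
  intros h e; apply h; unfold lnorm; rewrite e, Rabs_R0; apply sqrt_0.
Qed.

Lemma lnorm_sqr (X : R31) : lnorm X * lnorm X = Rabs (g X X).
Proof. apply sqrt_sqrt, Rabs_pos. Qed.

Lemma lnorm_pos (X : R31) : g X X <> 0 -> 0 < lnorm X.
Proof. intros h; apply sqrt_lt_R0, Rabs_pos_lt, h. Qed.

Lemma g_normalized (X : R31) :
  g X X <> 0 ->
  g (scal (/ lnorm X) X) (scal (/ lnorm X) X) = g X X / Rabs (g X X).
Proof.
  intros h; pose proof (lnorm_pos X h).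
  rewrite g_scal_l, g_scal_r, <- lnorm_sqr; field; lra.
Qed.

(** * The Frenet frame of the natural lift *)

(** The sign sigma covers both conventions for the binormal, and
    g M M <> 0 both causal characters of the principal normal. *)
Definition frame_at (E M B : R31) : Prop :=
  g E E = 1 /\ g E M = 0 /\ g M M <> 0 /\
  exists sigma : R, sigma * sigma = 1 /\ B = scal sigma (cross E M).

Lemma frame_gram (E M B : R31) :
  frame_at E M B ->
  g E E = 1 /\ g E M = 0 /\ g E B = 0 /\ g M B = 0 /\ g M M <> 0 /\
  g B B = - g M M.
Proof.
  intros (hE & hEM & hM & sg & hsg & ->).
  rewrite !g_scal_r, g_scal_l, g_cross_l, g_cross_r, g_cross_cross, hE, hEM.
  repeat split; try easy; try ring.
  transitivity (- (sg * sg) * g M M); [ring | rewrite hsg; ring].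
Qed.

(** The vectors are mutually orthogonal and none has square 0; pairing with
    each of them isolates one coefficient. *)
Lemma frame_free (E M B : R31) (p q r : R) :
  frame_at E M B ->
  plus (scal p E) (plus (scal q M) (scal r B)) = zero ->
  p = 0 /\ q = 0 /\ r = 0.
Proof.
  intros hF h.
  destruct (frame_gram E M B hF) as (hE & hEM & hEB & hMB & hM & hB).
  assert (k : forall Z, p * g E Z + (q * g M Z + r * g B Z) = 0).
  { intros Z; rewrite <- !g_scal_l, <- !g_plus_l.
    exact (eq_trans (f_equal (fun X => g X Z) h) (g_zero_l Z)). }
  pose proof (k E) as kE; pose proof (k M) as kM; pose proof (k B) as kB.
  rewrite (g_sym M E), (g_sym B E), hE, hEM, hEB in kE.
  rewrite (g_sym B M), hEM, hMB in kM.
  rewrite hEB, hMB, hB in kB.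
  split; [lra |].
  split; apply (Rmult_eq_reg_r (g M M)); try exact hM; lra.
Qed.

Lemma frame_cross (E M B : R31) (k p q r : R) :
  frame_at E M B ->
  exists sigma, sigma * sigma = 1 /\
    cross (scal k E) (plus (scal p E) (plus (scal q M) (scal r B)))
    = plus (scal (k * sigma * r) M) (scal (k * sigma * q) B).
Proof.
  intros (hE & hEM & hM & sg & hsg & hB); exists sg; split; [exact hsg |].
  assert (bil : cross (scal k E) (plus (scal p E) (plus (scal q M) (scal r B)))
    = plus (scal (k * q) (cross E M)) (scal (k * r) (cross E B))).
  { destruct E as [[? ?] ?], M as [[? ?] ?], B as [[? ?] ?].
    apply R31_eq; coords; ring. }
  assert (eB : cross E M = scal sg B).
  { rewrite hB; rewrite scal_assoc.
    change (cross E M = scal (sg * sg) (cross E M)).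
    rewrite hsg; symmetry; apply (scal_one (cross E M)). }
  assert (cB : cross E B = scal sg M).
  { transitivity (scal sg (cross E (cross E M))).
    - rewrite hB; generalize (cross E M); intros [[? ?] ?].
      destruct E as [[? ?] ?]; apply R31_eq; coords; ring.
    - rewrite cross_cross, hE, hEM.
      destruct E as [[? ?] ?], M as [[? ?] ?]; apply R31_eq; coords; ring. }
  rewrite bil, eB, cB.
  destruct M as [[? ?] ?], B as [[? ?] ?]; apply R31_eq; coords; ring.
Qed.

(** The vector n is a combination of M and B alone, with coefficients
    proportional to r and q; pairing with M and B reads them off. *)
Lemma normal_parallel_binormal (E M B : R31) (k p q r : R) :
  frame_at E M B -> k <> 0 ->
  let n := cross (scal k E)
             (plus (scal p E) (plus (scal q M) (scal r B))) in
  (n <> zero /\ parallel n B) <-> (r = 0 /\ q <> 0).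
Proof.
  intros hF hk n.
  destruct (frame_cross E M B k p q r hF) as (sg & hsg & hn); fold n in hn.
  destruct (frame_gram E M B hF) as (_ & _ & _ & hMB & hM & hB).
  assert (hsg0 : sg <> 0) by (intros e; rewrite e in hsg; lra).
  assert (hks : k * sg <> 0) by now apply Rmult_integral_contrapositive.
  assert (hnM : g n M = k * sg * r * g M M).
  { rewrite hn, g_plus_l, !g_scal_l, (g_sym B M), hMB; ring. }
  assert (hnB : g n B = k * sg * q * - g M M).
  { rewrite hn, g_plus_l, !g_scal_l, hMB, hB; ring. }
  split.
  - intros [hn0 [c hc]].
    assert (hr : r = 0).
    { rewrite hc, g_scal_l, (g_sym B M), hMB in hnM.
      assert (h0 : k * sg * r * g M M = 0) by lra.
      apply Rmult_integral in h0; destruct h0 as [h0 | h0]; [| easy].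
      now apply Rmult_integral in h0; destruct h0. }
    split; [exact hr |]; intros hq; apply hn0.
    rewrite hn, hr, hq; destruct M as [[? ?] ?], B as [[? ?] ?].
    apply R31_eq; coords; ring.
  - intros [hr hq]; split.
    + intros e; rewrite e, g_zero_l in hnB.
      assert (h : k * sg * q * g M M <> 0)
        by (repeat apply Rmult_integral_contrapositive_currified; auto).
      lra.
    + exists (k * sg * q); rewrite hn, hr.
      destruct M as [[? ?] ?], B as [[? ?] ?]; apply R31_eq; coords; ring.
Qed.

(** Where c' is spacelike the absolute value in its norm is harmless, and
    c' / sqrt (g(c', c')) is differentiable by the chain rule. *)
Lemma tangent_differentiable (a b : R) (c : R -> R31) (s : R) :
  a < b -> a <= s <= b -> smooth_curve a b c ->
  (forall r, a <= r <= b -> 0 < g (VDerive_on a b c r) (VDerive_on a b c r)) ->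
  is_vderive_on a b (tangent a b c) s (VDerive_on a b (tangent a b c) s).
Proof.
  intros hab hs hc hpos.
  pose proof (smooth_curve_deriv a b _ s hab hs (smooth_curve_VDerive a b c hc))
    as hd.
  set (d := VDerive_on a b c) in *.
  pose proof (is_derive_on_g a b d d s _ _ hab hs hd hd) as hg.
  assert (hi : exists m, is_derive (fun y => / sqrt y) (g (d s) (d s)) m).
  { assert (0 < sqrt (g (d s) (d s))) by now apply sqrt_lt_R0, hpos.
    eexists; auto_derive; [| reflexivity].
    split; [now apply hpos | split; [lra | easy]]. }
  destruct hi as [m hi].
  pose proof (is_derive_on_comp a b _ _ s _ m hab hs hg hi) as hq.
  pose proof (is_vderive_on_scal a b _ d s _ _ hab hs hq hd) as hE.
  match type of hE with is_vderive_on _ _ _ _ ?V => set (W := V) in hE end.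
  assert (hE' : is_vderive_on a b (tangent a b c) s W).
  { eapply is_vderive_on_ext; [exact hab | exact hs | | exact hE].
    intros r hr; unfold tangent; fold d; unfold lnorm.
    rewrite Rabs_pos_eq; [reflexivity | apply Rlt_le; now apply hpos]. }
  now rewrite (VDerive_on_eq a b _ s W hab hs hE').
Qed.

(** The position vector of the lift is alpha', of constant square -1; its
    derivative is therefore orthogonal to it, hence spacelike. *)
Lemma natural_lift_speed (a b : R) (alpha : R -> R31) (s : R) :
  a < b -> a <= s <= b ->
  smooth_curve a b alpha -> timelike_curve a b alpha -> unit_speed a b alpha ->
  curvature a b alpha s <> 0 ->
  let T' := VDerive_on a b (natural_lift a b alpha) s in
  g T' (natural_lift a b alpha s) = 0 /\ 0 < g T' T'.
Proof.
  intros hab hs halpha ht hu hk; unfold natural_lift; cbv zeta.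
  pose proof (smooth_curve_deriv a b _ s hab hs
    (smooth_curve_VDerive a b alpha halpha)) as hd.
  assert (h0 : g (VDerive_on a b (VDerive_on a b alpha) s)
                 (VDerive_on a b alpha s) = 0).
  { assert (h := g_const_deriv a b (-1) _ _ s _ _ hab hs hd hd).
    rewrite (g_sym (VDerive_on a b alpha s)) in h.
    enough (forall r, a <= r <= b ->
              g (VDerive_on a b alpha r) (VDerive_on a b alpha r) = -1)
      by (specialize (h H); lra).
    intros r hr; pose proof (lnorm_sqr (VDerive_on a b alpha r)) as e.
    pose proof (ht r hr) as hr'; unfold timelike in hr'.
    rewrite (hu r hr), Rabs_left in e by exact hr'; lra. }
  split; [exact h0 |].
  pose proof (lnorm_neq0 _ hk) as hne.
  rewrite g_sym in h0.
  pose proof (orthogonal_timelike _ _ (ht s hs) h0) as hge; lra.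
Qed.

Lemma natural_lift_frame (a b : R) (alpha : R -> R31) (s : R) :
  a < b -> a <= s <= b ->
  smooth_curve a b alpha -> timelike_curve a b alpha -> unit_speed a b alpha ->
  (forall r, a <= r <= b -> curvature a b alpha r <> 0) ->
  principal_normal_never_null a b (natural_lift a b alpha) ->
  let c := natural_lift a b alpha in
  frame_at (tangent a b c s) (normal a b c s) (binormal a b c s) /\
  exists k, k <> 0 /\ VDerive_on a b c s = scal k (tangent a b c s).
Proof.
  intros hab hs halpha ht hu hk hnn c.
  assert (hc : smooth_curve a b c) by now apply smooth_curve_VDerive.
  assert (hsp : forall r, a <= r <= b ->
    g (VDerive_on a b c r) (c r) = 0 /\
    0 < g (VDerive_on a b c r) (VDerive_on a b c r))
    by (intros r hr; apply natural_lift_speed; auto).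
  assert (hpos : forall r, a <= r <= b ->
    0 < g (VDerive_on a b c r) (VDerive_on a b c r))
    by (intros r hr; now apply hsp).
  pose proof (smooth_curve_deriv a b c s hab hs hc) as dc.
  pose proof (tangent_differentiable a b c s hab hs hc hpos) as dE.
  assert (hEE : forall r, a <= r <= b ->
    g (tangent a b c r) (tangent a b c r) = 1).
  { intros r hr; pose proof (hpos r hr).
    unfold tangent; rewrite g_normalized by lra.
    rewrite Rabs_pos_eq by lra; field; lra. }
  assert (hEc : forall r, a <= r <= b -> g (c r) (tangent a b c r) = 0).
  { intros r hr; unfold tangent; rewrite g_scal_r, g_sym.
    rewrite (proj1 (hsp r hr)); ring. }
  pose proof (lnorm_pos _ (Rgt_not_eq _ _ (hpos s hs))) as hl.
  set (E' := VDerive_on a b (tangent a b c) s) in *.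
  assert (hEE' : g (tangent a b c s) E' = 0).
  { pose proof (g_const_deriv a b 1 _ _ s _ _ hab hs dE dE hEE) as h.
    rewrite (g_sym E') in h; lra. }
  (* If E' vanished, differentiating g(c, E) = 0 would leave g(c', E) = 0,
     whereas g(c', E) is the length of c'. *)
  assert (hE'0 : E' <> zero).
  { intros e.
    pose proof (g_const_deriv a b 0 _ _ s _ _ hab hs dc dE hEc) as h.
    rewrite e, (g_sym _ zero), g_zero_l in h.
    unfold tangent in h; rewrite g_scal_r in h.
    assert (/ lnorm (VDerive_on a b c s) > 0) by now apply Rinv_0_lt_compat.
    pose proof (hpos s hs); nra. }
  assert (hE'n : g E' E' <> 0).
  { intros e; apply (hnn s hs); split; [exact e | exact hE'0]. }
  split.
  - split; [now apply hEE |].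
    split; [unfold normal; fold E'; rewrite g_scal_r, hEE'; ring |].
    split.
    + unfold normal; fold E'; rewrite g_normalized by exact hE'n.
      apply Rmult_integral_contrapositive_currified; [exact hE'n |].
      now apply Rinv_neq_0_compat, Rabs_no_R0.
    + unfold binormal; cbv zeta.
      destruct (Rlt_dec _ _) as [_ | _].
      * exists 1; split; [ring |].
        symmetry; apply (scal_one (cross _ _)).
      * exists (-1); split; [ring |].
        symmetry; apply (scal_opp_one (cross _ _)).
  - exists (lnorm (VDerive_on a b c s)); split; [lra |].
    unfold tangent; rewrite scal_assoc.
    change (VDerive_on a b c s
      = scal (lnorm (VDerive_on a b c s) * / lnorm (VDerive_on a b c s))
          (VDerive_on a b c s)).
    rewrite Rinv_r by lra; symmetry; apply (scal_one (VDerive_on a b c s)).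
Qed.

(** * The surface along the curve *)

Lemma frame_surface_dt (L1 L2 T1 T2 : R) (c : R -> R31)
  (u v w : R -> R -> R) (s t : R) :
  T1 < T2 -> T1 <= t <= T2 ->
  ex_derive_on T1 T2 (fun r => u s r) t ->
  ex_derive_on T1 T2 (fun r => v s r) t ->
  ex_derive_on T1 T2 (fun r => w s r) t ->
  VDerive_on T1 T2 (fun r => frame_surface L1 L2 c u v w s r) t
  = plus (scal (dt T1 T2 u s t) (tangent L1 L2 c s))
      (plus (scal (dt T1 T2 v s t) (normal L1 L2 c s))
            (scal (dt T1 T2 w s t) (binormal L1 L2 c s))).
Proof.
  intros hT ht hu hv hw.
  apply (Derive_on_correct T1 T2 _ t hT ht) in hu, hv, hw.
  assert (term : forall f (X : R31) l, is_derive_on T1 T2 f t l ->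
    is_vderive_on T1 T2 (fun r => scal (f r) X) t (scal l X)).
  { intros f X l hf.
    replace (scal l X) with (plus (scal l X) (scal (f t) (zero : R31)))
      by (destruct X as [[? ?] ?]; apply R31_eq; coords; ring).
    apply is_vderive_on_scal; auto using is_vderive_on_const. }
  apply VDerive_on_eq; [exact hT | exact ht |].
  rewrite <- plus_zero_l.
  apply is_vderive_on_plus; [exact hT | exact ht |
    now apply is_vderive_on_const |].
  apply is_vderive_on_plus; [exact hT | exact ht | now apply term |].
  apply is_vderive_on_plus; [exact hT | exact ht | now apply term |].
  now apply term.
Qed.

(** This is where the linear independence of the frame enters. *)
Lemma isoparametric_iff (L1 L2 t0 : R) (c : R -> R31) (u v w : R -> R -> R) :
  (forall s, L1 <= s <= L2 ->
     frame_at (tangent L1 L2 c s) (normal L1 L2 c s) (binormal L1 L2 c s)) ->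
  isoparametric L1 L2 c (frame_surface L1 L2 c u v w) t0 <->
  (forall s, L1 <= s <= L2 -> u s t0 = 0 /\ v s t0 = 0 /\ w s t0 = 0).
Proof.
  intros hF; split; intros h s hs.
  - apply (frame_free _ _ _ _ _ _ (hF s hs)).
    specialize (h s hs); unfold frame_surface in h.
    apply (plus_reg_l (c s)); rewrite plus_zero_r; exact h.
  - destruct (h s hs) as (h1 & h2 & h3).
    unfold frame_surface; rewrite h1, h2, h3.
    rewrite !(scal_zero_l (K := R_AbsRing)), !plus_zero_r; reflexivity.
Qed.

Theorem mainTheorem1 (L1 L2 T1 T2 t0 : R) (alpha : R -> R31)
  (u v w : R -> R -> R)
  (hL : L1 < L2) (hT : T1 < T2) (ht0 : T1 <= t0 <= T2)
  (halpha : smooth_curve L1 L2 alpha)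
  (htimelike : timelike_curve L1 L2 alpha)
  (hunit : unit_speed L1 L2 alpha)
  (hcurv : forall s, L1 <= s <= L2 -> curvature L1 L2 alpha s <> 0)
  (hnormal : principal_normal_never_null L1 L2 (natural_lift L1 L2 alpha))
  (hu : C1_on L1 L2 T1 T2 u)
  (hv : C1_on L1 L2 T1 T2 v)
  (hw : C1_on L1 L2 T1 T2 w) :
  asymptotic_curve L1 L2 T1 T2 (natural_lift L1 L2 alpha)
    (frame_surface L1 L2 (natural_lift L1 L2 alpha) u v w) t0
  <->
  (forall s, L1 <= s <= L2 ->
     u s t0 = 0 /\ v s t0 = 0 /\ w s t0 = 0 /\ dt T1 T2 w s t0 = 0 /\
     dt T1 T2 v s t0 <> 0).
Proof.
  set (c := natural_lift L1 L2 alpha) in *.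
  set (P := frame_surface L1 L2 c u v w).
  assert (hc : smooth_curve L1 L2 c) by now apply smooth_curve_VDerive.
  assert (hF := fun s hs => natural_lift_frame L1 L2 alpha s hL hs
    halpha htimelike hunit hcurv hnormal); cbv zeta in hF; fold c in hF.
  assert (hiso := isoparametric_iff L1 L2 t0 c u v w
    (fun s hs => proj1 (hF s hs))); fold P in hiso.
  assert (hn : isoparametric L1 L2 c P t0 -> forall s, L1 <= s <= L2 ->
    (surface_normal L1 L2 T1 T2 P s t0 <> zero /\
     parallel (surface_normal L1 L2 T1 T2 P s t0) (binormal L1 L2 c s))
    <-> (dt T1 T2 w s t0 = 0 /\ dt T1 T2 v s t0 <> 0)).
  { intros hP s hs; destruct (hF s hs) as [hfr [k [hk hck]]].
    (* P(., t0) coincides with c on the whole interval, so it inherits the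
       derivative of c, also the one-sided ones at the endpoints. *)
    assert (hs' : VDerive_on L1 L2 (fun r => P r t0) s
                  = scal k (tangent L1 L2 c s)).
    { rewrite <- hck; apply VDerive_on_eq; [exact hL | exact hs |].
      apply (is_vderive_on_ext L1 L2 c); [exact hL | exact hs | |].
      - intros r hr; symmetry; now apply hP.
      - now apply smooth_curve_deriv. }
    unfold surface_normal; rewrite hs'; unfold P.
    rewrite frame_surface_dt; [| exact hT | exact ht0 | | |].
    - now apply normal_parallel_binormal.
    - now apply (proj1 hu).
    - now apply (proj1 hv).
    - now apply (proj1 hw). }
  split.
  - intros [hP h] s hs.
    destruct (proj1 hiso hP s hs) as (h1 & h2 & h3).
    destruct (proj1 (hn hP s hs) (h s hs)); auto.
  - intros h.
    assert (hP : isoparametric L1 L2 c P t0).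
    { apply hiso; intros s hs; destruct (h s hs) as (h1 & h2 & h3 & _); auto. }
    split; [exact hP |]; intros s hs; apply (hn hP s hs).
    now destruct (h s hs) as (_ & _ & _ & h4 & h5).
Qed.
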